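(* Let $\mathcal{A}\in S_{m,n}$ be strictly semi-positive and let $\mathbf{q}\in\mathbb{R}^n$. If $\mathbf{x}$ is a solution of the tensor complementarity problem TCP$(\mathcal{A},\mathbf{q})$, then $$\|\mathbf{x}\|_2^{m-1}\le\frac{\|(-\mathbf{q})_+\|_2}{\mu(\mathcal{A})}.$$
   Context: A real $m$th order $n$-dimensional tensor is an array $\mathcal{A}=(a_{i_1\cdots i_m})$ of real numbers, $1\le i_1,\dots,i_m\le n$, with order $m\ge 2$; $S_{m,n}$ is the set of those that are symmetric, i.e. whose entries are invariant under any permutation of the indices. For $\mathbf{x}\in\mathbb{R}^n$, $\mathcal{A}\mathbf{x}^{m-1}\in\mathbb{R}^n$ is the vector with components $(\mathcal{A}\mathbf{x}^{m-1})_i=\sum_{i_2,\dots,i_m=1}^n a_{ii_2\cdots i_m}x_{i_2}\cdots x_{i_m}$, and $\mathcal{A}\mathbf{x}^m=\mathbf{x}^\top(\mathcal{A}\mathbf{x}^{m-1})$. For vectors, $\mathbf{x}\ge\mathbf{0}$ means $x_i\ge 0$ for all $i$. $\mathcal{A}$ is strictly semi-positive iff for each $\mathbf{x}\ge\mathbf{0}$ with $\mathbf{x}\ne\mathbf{0}$ there is an index $k\in\{1,\dots,n\}$ with $x_k>0$ and $(\mathcal{A}\mathbf{x}^{m-1})_k>0$. A solution of TCP$(\mathcal{A},\mathbf{q})$ is a vector $\mathbf{x}\in\mathbb{R}^n$ with $\mathbf{x}\ge\mathbf{0}$, $\mathbf{q}+\mathcal{A}\mathbf{x}^{m-1}\ge\mathbf{0}$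 and $\mathbf{x}^\top(\mathbf{q}+\mathcal{A}\mathbf{x}^{m-1})=0$. $\|\cdot\|_2$ is the Euclidean norm; $\mathbf{x}_+=(\max\{x_1,0\},\dots,\max\{x_n,0\})^\top$; and $$\mu(\mathcal{A}):=\min\{\mathcal{A}\mathbf{y}^m:\ \mathbf{y}\ge\mathbf{0},\ \|\mathbf{y}\|_2=1\}.$$ *)

(* Defs.v *)
From HB Require Import structures.
From mathcomp Require Import all_boot all_order all_algebra all_fingroup.
From mathcomp Require Import all_classical all_reals.

Set Implicit Arguments.
Unset Strict Implicit.
Unset Printing Implicit Defensive.

Import Order.TTheory GRing.Theory Num.Theory.
Local Open Scope classical_set_scope.
Local Open Scope ring_scope.

Section Tensor.
Variables (R : realType) (m n : nat).

(* An entry is indexed by a multi-index (i_1, ..., i_m), seen as a finite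
   function 'I_m -> 'I_n. *)
Definition tensor := {ffun 'I_m -> 'I_n} -> R.

Implicit Types (A : tensor) (x q : 'cV[R]_n).

Definition symmetric_tensor A : Prop :=
  forall (s : {perm 'I_m}) (f : {ffun 'I_m -> 'I_n}),
    A [ffun k => f (s k)] = A f.

(* The multi-index (i, t_1, ..., t_(m-1)).  For m > 0 the list has length m, so
   the default value of nth is never used. *)
Definition multi_index (i : 'I_n) (t : m.-1.-tuple 'I_n) : {ffun 'I_m -> 'I_n} :=
  [ffun k : 'I_m => nth i (i :: t) k].

(* A x^(m-1) *)
Definition tensor_app A x : 'cV[R]_n :=
  \col_i \sum_(t : m.-1.-tuple 'I_n)
    A (multi_index i t) * \prod_(j < m.-1) x (tnth t j) 0.

Definition dot (u v : 'cV[R]_n) : R := (u^T *m v) 0 0.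

(* A x^m *)
Definition tensor_form A x : R := dot x (tensor_app A x).

Definition nonneg_vec x : Prop := forall i, 0 <= x i 0.

(* The norm `|x| of MathComp-Analysis on matrices is the sup norm. *)
Definition norm2 x : R := Num.sqrt (\sum_i x i 0 ^+ 2).

Definition pos_part x : 'cV[R]_n := \col_i Num.max (x i 0) 0.

Definition strictly_semi_positive A : Prop :=
  forall x, nonneg_vec x -> x <> 0 ->
    exists k : 'I_n, 0 < x k 0 /\ 0 < tensor_app A x k 0.

Definition TCP_solution A q x : Prop :=
  [/\ nonneg_vec x, nonneg_vec (q + tensor_app A x)
    & dot x (q + tensor_app A x) = 0].

End Tensor.

Definition is_min (R : realType) (S : set R) (v : R) : Prop :=
  S v /\ forall w, S w -> v <= w.

(* The least element of S; the value is 0 when S has none. *)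
Definition set_min (R : realType) (S : set R) : R := xget 0 [set v | is_min S v].

(* For n > 0 the set is the continuous image of a nonempty compact set, so it
   has a least element and the default value of set_min is not used. *)
Definition mu (R : realType) (m n : nat) (A : tensor R m n) : R :=
  set_min [set tensor_form A y | y in [set y | nonneg_vec y /\ norm2 y = 1]].

(* Main.v *)
Require Import Defs.
From HB Require Import structures.
From mathcomp Require Import all_boot all_order all_algebra all_fingroup.
From mathcomp Require Import all_classical all_reals.
From mathcomp Require Import topology normedtype.
From mathcomp Require derive.
From mathcomp Require Import ring lra.

Set Implicit Arguments.
Unset Strict Implicit.
Unset Printing Implicit Defensive.

Import Order.TTheory GRing.Theory Num.Theory.
Import numFieldNormedType.Exports.
Local Open Scope classical_set_scope.
Local Open Scope ring_scope.

(** The bound would be immediate if A x^m >= mu(A) |x|^m with mu(A) > 0: by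
    complementarity A x^m = <x, -q> <= <x, (-q)_+> <= |x| |(-q)_+|, and one
    divides by |x| mu(A).  The inequality is the definition of mu(A) together
    with homogeneity (mu_norm2_le_form), once the minimum is known to exist by
    compactness (mu_attained).

    The substance is mu(A) > 0 (mu_gt0), and this is where symmetry enters.
    Suppose mu(A) <= 0 and let y be a minimizer of A y^m on the nonnegative part
    of the unit sphere.  Strict semi-positivity gives k with y_k > 0 and
    (A y^(m-1))_k > 0.  For a symmetric tensor the k-th partial derivative of
    y |-> A y^m is m (A y^(m-1))_k, so lowering y_k slightly to z = y - t e_k
    makes the form strictly smaller than mu(A).  But z is still nonnegative and
    |z| <= 1, whence A z^m >= mu(A) |z|^m >= mu(A) because mu(A) <= 0: a
    contradiction.  Moving only towards the origin replaces the Lagrange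
    multiplier of the sphere constraint by the monotonicity of the norm.

    Along the segment the form is a polynomial in t, so the formal derivative of
    polynomials suffices (line_poly, deriv_line_poly). *)

(** * The form as a sum over multi-indices *)

Lemma multi_index0 m n (i : 'I_n) (t : m.-tuple 'I_n) :
  @multi_index m.+1 n i t ord0 = i.
Proof. by rewrite ffunE. Qed.

Lemma multi_index_lift m n (i : 'I_n) (t : m.-tuple 'I_n) (j : 'I_m) :
  @multi_index m.+1 n i t (lift ord0 j) = tnth t j.
Proof. by rewrite ffunE (tnth_nth i). Qed.

Lemma sum_multi_index (V : nmodType) m n (F : {ffun 'I_m.+1 -> 'I_n} -> V) :
  \sum_i \sum_(t : m.-tuple 'I_n) F (@multi_index m.+1 n i t) = \sum_f F f.
Proof.
rewrite pair_big /=.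
pose h (f : {ffun 'I_m.+1 -> 'I_n}) := (f ord0, [tuple f (lift ord0 j) | j < m]).
rewrite [RHS](reindex (fun p : 'I_n * m.-tuple 'I_n =>
  @multi_index m.+1 n p.1 p.2)) //.
exists h => [[i t] _ | f _]; rewrite /h.
  by congr pair; [exact: multi_index0 |
    apply/eq_from_tnth => j; rewrite tnth_mktuple multi_index_lift].
apply/ffunP => j; have [l ->|->] := unliftP ord0 j.
  by rewrite multi_index_lift tnth_mktuple.
by rewrite multi_index0.
Qed.

Lemma dotE (R : realType) n (u v : 'cV[R]_n) : dot u v = \sum_i u i 0 * v i 0.
Proof. by rewrite /dot mxE; apply: eq_bigr => i _; rewrite mxE. Qed.

(** Indexing by all multi-indices at once treats the m positions alike, which is
    what the symmetry of the tensor acts on. *)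
Lemma tensor_formE (R : realType) m n (A : tensor R m.+1 n) x :
  tensor_form A x = \sum_f A f * \prod_j x (f j) 0.
Proof.
rewrite /tensor_form dotE -sum_multi_index.
apply: eq_bigr => i _; rewrite mxE big_distrr /=; apply: eq_bigr => t _.
rewrite big_ord_recl multi_index0 mulrCA; congr (_ * (_ * _)).
by apply: eq_bigr => j _; rewrite multi_index_lift.
Qed.

Lemma tensor_formZ (R : realType) m n (A : tensor R m.+1 n) c x :
  tensor_form A (c *: x) = c ^+ m.+1 * tensor_form A x.
Proof.
rewrite !tensor_formE big_distrr /=; apply: eq_bigr => f _.
under eq_bigr do rewrite mxE.
by rewrite big_split /= prodr_const card_ord mulrCA.
Qed.

(** * The derivative of the form in a coordinate direction *)

Lemma deriv_prod (R : comNzRingType) m (p : 'I_m -> {poly R}) :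
  (\prod_j p j)^`() = \sum_j (p j)^`() * \prod_(i | i != j) p i.
Proof.
elim: m p => [|m IH] p; first by rewrite !big_ord0 derivC.
rewrite big_ord_recl derivM IH big_ord_recl; congr (_ + _).
  by rewrite [in RHS]big_mkcond big_ord_recl /= mul1r.
rewrite big_distrr; apply: eq_bigr => j _ /=.
rewrite [in RHS]big_mkcond big_ord_recl /= mulrCA; congr (_ * (_ * _)).
by rewrite big_mkcond.
Qed.

(** The left-hand side is the k-th partial derivative of A x^m, by the product
    rule.  Exchanging positions 0 and j in the multi-index leaves a symmetric
    tensor unchanged, so each of the m positions contributes as much as position
    0, whose contribution is (A x^(m-1))_k. *)
Lemma sum_partials_symmetric (R : realType) m n (A : tensor R m.+1 n)
    (x : 'cV[R]_n) k :
    symmetric_tensor A ->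
  \sum_f A f * (\sum_(j | f j == k) \prod_(i | i != j) x (f i) 0)
    = m.+1%:R * tensor_app A x k 0.
Proof.
move=> sA.
pose swap j (f : {ffun 'I_m.+1 -> 'I_n}) := [ffun l => f (tperm ord0 j l)].
under eq_bigr do rewrite big_distrr big_mkcond.
rewrite exchange_big /=.
under eq_bigr => j _.
  rewrite (reindex (swap j)) /=; last first.
    by exists (swap j) => f _; apply/ffunP => l; rewrite !ffunE tpermK.
  under eq_bigr => f _.
    rewrite sA ffunE tpermR (reindex_inj (@perm_inj _ (tperm ord0 j))) /=.
    under eq_bigl => l.
      rewrite -(inj_eq (@perm_inj _ (tperm ord0 j))) tpermK tpermR.
      over.
    under eq_bigr => l _ do rewrite ffunE tpermK.
    over.
  over.
rewrite sumr_const card_ord mulr_natl; congr (_ *+ _).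
rewrite -(sum_multi_index (fun f => if f ord0 == k then _ else _)).
rewrite (bigD1 k) //= [X in _ + X]big1 ?addr0 => [|i /negPf ik]; last first.
  by apply: big1 => t _; rewrite multi_index0 ik.
rewrite mxE; apply: eq_bigr => t _; rewrite multi_index0 eqxx; congr (_ * _).
rewrite big_mkcond big_ord_recl /= mul1r.
by apply: eq_bigr => j _; rewrite multi_index_lift.
Qed.

(** The polynomial t |-> A (x - t e_k)^m. *)
Definition line_poly (R : realType) m n (A : tensor R m.+1 n) (x : 'cV[R]_n) k :
    {poly R} :=
  \sum_f A f *: \prod_j ((x (f j) 0)%:P - (f j == k)%:R *: 'X).

Lemma horner_line_poly (R : realType) m n (A : tensor R m.+1 n) x k t :
  (line_poly A x k).[t] = tensor_form A (x - t *: delta_mx k 0).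
Proof.
rewrite tensor_formE horner_sum; apply: eq_bigr => f _.
rewrite hornerZ horner_prod; congr (_ * _); apply: eq_bigr => j _.
by rewrite !hornerE !mxE eqxx andbT mulrC.
Qed.

Lemma deriv_line_poly (R : realType) m n (A : tensor R m.+1 n) x k :
    symmetric_tensor A ->
  (line_poly A x k)^`().[0] = - (m.+1%:R * tensor_app A x k 0).
Proof.
move=> sA; rewrite -(sum_partials_symmetric x k sA) raddf_sum /= horner_sum -sumrN.
apply: eq_bigr => f _; rewrite derivZ hornerZ -mulrN; congr (_ * _).
rewrite deriv_prod horner_sum -sumrN [RHS]big_mkcond; apply: eq_bigr => j _.
rewrite hornerM horner_prod !derivE !hornerE.
under eq_bigr do rewrite !hornerE subr0.
by case: eqP => _; rewrite ?mulN1r ?mulr0n ?oppr0 ?mul0r.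
Qed.

(** Writing p - p(0) = 'X * r, the derivative at 0 is r(0), and r is nonnegative
    just to the right of 0, hence at 0 by continuity. *)
Lemma deriv_ge0_at_right_min (R : realType) (p : {poly R}) (d : R) :
  0 < d -> (forall t, 0 < t < d -> p.[0] <= p.[t]) -> 0 <= p^`().[0].
Proof.
move=> d0 pmin.
have /factor_theorem [r pr] : root (p - p.[0]%:P) 0.
  by rewrite rootE !hornerE subrr.
have -> : p^`().[0] = r.[0].
  rewrite -[p](subrK p.[0]%:P) pr !derivE !hornerE.
  by rewrite oppr0 mulr0 add0r.
rewrite leNgt; apply/negP => r0.
have /cvgr_lt/(_ _ r0) := @derive.continuous_horner R r 0.
move=> /nbhs_ballP[e /= e0 be].
have [t [t0 te td]] : exists t, [/\ 0 < t, t < e & t < d].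
  exists (Num.min e d / 2); rewrite divr_gt0 ?lt_min ?e0 //.
  by split=> //; case: (leP e d) => ?; lra.
have rt : r.[t] < 0.
  by apply: be; rewrite /ball /= sub0r normrN gtr0_norm.
have : p.[t] - p.[0] = r.[t] * t.
  by have := congr1 (fun s : {poly R} => s.[t]) pr; rewrite /= !hornerE subr0.
have := pmin t; rewrite t0 td => /(_ isT); nra.
Qed.

(** * The Euclidean norm *)

Lemma norm2_ge0 (R : realType) n (x : 'cV[R]_n) : 0 <= norm2 x.
Proof. exact: sqrtr_ge0. Qed.

Lemma norm2_sq (R : realType) n (x : 'cV[R]_n) : norm2 x ^+ 2 = \sum_i x i 0 ^+ 2.
Proof. by rewrite sqr_sqrtr //; apply: sumr_ge0 => i _; exact: sqr_ge0. Qed.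

Lemma norm2_eq0 (R : realType) n (x : 'cV[R]_n) : (norm2 x == 0) = (x == 0).
Proof.
rewrite -sqrf_eq0 norm2_sq psumr_eq0 => [|i _]; last exact: sqr_ge0.
apply/allP/eqP => [h | -> i _]; last by rewrite mxE expr0n eqxx.
apply/colP => i; apply/eqP; rewrite mxE -sqrf_eq0; apply: h.
exact: mem_index_enum.
Qed.

Lemma norm2Z (R : realType) n c (x : 'cV[R]_n) : norm2 (c *: x) = `|c| * norm2 x.
Proof.
rewrite /norm2 -sqrtr_sqr -sqrtrM ?sqr_ge0 // big_distrr /=.
by congr Num.sqrt; apply: eq_bigr => i _; rewrite mxE exprMn.
Qed.

Lemma ler_norm2 (R : realType) n (x y : 'cV[R]_n) :
  (forall i, 0 <= x i 0 <= y i 0) -> norm2 x <= norm2 y.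
Proof.
move=> xy; apply: ler_wsqrtr; apply: ler_sum => i _.
by have /andP[x0 xyi] := xy i; rewrite lerXn2r ?nnegrE ?(le_trans x0).
Qed.

(** Cauchy-Schwarz, from the nonnegativity of the squared norm of
    |u|^2 v - <u, v> u, which equals |u|^2 (|u|^2 |v|^2 - <u, v>^2). *)
Lemma dot_le_norm2 (R : realType) n (u v : 'cV[R]_n) : dot u v <= norm2 u * norm2 v.
Proof.
have [/eqP|u0] := eqVneq (norm2 u) 0.
  rewrite norm2_eq0 => /eqP ->; rewrite dotE big1 ?mulr_ge0 ?norm2_ge0 //.
  by move=> i _; rewrite mxE mul0r.
have up : 0 < norm2 u by rewrite lt_def u0 norm2_ge0.
have : 0 <= \sum_i (norm2 u ^+ 2 * v i 0 - dot u v * u i 0) ^+ 2.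
  by apply: sumr_ge0 => i _; rewrite sqr_ge0.
under eq_bigr => i _.
  rewrite (_ : _ ^+ 2 = norm2 u ^+ 2 * norm2 u ^+ 2 * (v i 0 ^+ 2)
    - (norm2 u ^+ 2 * dot u v *+ 2) * (u i 0 * v i 0)
    + dot u v ^+ 2 * u i 0 ^+ 2); last ring.
  over.
rewrite big_split /= sumrB -!big_distrr /= -!norm2_sq -dotE.
rewrite (_ : _ + _ =
  norm2 u ^+ 2 * ((norm2 u * norm2 v) ^+ 2 - dot u v ^+ 2)); last ring.
rewrite pmulr_rge0 ?exprn_gt0 // subr_ge0 => h.
apply: (le_trans (ler_norm _)).
by rewrite -ler_sqr ?nnegrE ?mulr_ge0 ?norm2_ge0 // real_normK ?num_real.
Qed.

(** * The minimum of the form on the nonnegative unit vectors *)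

(** The nonnegative unit vectors form a closed subset of the cube [0, 1]^n;
    transposing them to row vectors makes rV_compact give compactness. *)
Lemma mu_attained (R : realType) m n (A : tensor R m.+1 n.+1) :
  exists y, [/\ nonneg_vec y, norm2 y = 1, tensor_form A y = mu A &
    forall z, nonneg_vec z -> norm2 z = 1 -> mu A <= tensor_form A z].
Proof.
pose f (v : 'rV[R]_n.+1) := tensor_form A v^T.
pose S := [set v : 'rV[R]_n.+1 | forall i, v ord0 i \in `[0, 1]]
  `&` [set v : 'rV[R]_n.+1 | \sum_i v ord0 i ^+ 2 = 1].
have SE (v : 'rV[R]_n.+1) : S v <-> nonneg_vec v^T /\ norm2 v^T = 1.
  have e : norm2 v^T ^+ 2 = \sum_i v ord0 i ^+ 2.
    by rewrite norm2_sq; apply: eq_bigr => i _; rewrite mxE.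
  split=> [[v01 /= v1]|[v0 v1]].
    split=> [i|]; first by have := v01 i; rewrite mxE in_itv /= => /andP[].
    by apply/eqP; rewrite -(@eqrXn2 _ 2) ?norm2_ge0 // e v1 expr1n.
  have s1 : \sum_i v ord0 i ^+ 2 = 1 by rewrite -e v1 expr1n.
  split=> // i; have := v0 i; rewrite mxE in_itv /= => vi0; rewrite vi0 /=.
  rewrite -(@expr_le1 _ 2) // -s1 (bigD1 i) //= lerDl.
  by apply: sumr_ge0 => j _; rewrite sqr_ge0.
have coordc i : continuous (fun v : 'rV[R]_n.+1 => v ord0 i).
  exact: coord_continuous.
have S0 : S !=set0.
  exists (delta_mx 0 0); split=> [i|] /=.
    by rewrite in_itv !mxE /=; case: (_ == _); rewrite ?lexx ?ler01.
  rewrite (bigD1 ord0) //= big1 ?addr0 => [|i /negPf i0]; rewrite !mxE ?eqxx ?expr1n //.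
  by rewrite i0 expr0n.
have Sc : compact S.
  apply: compact_closedI.
    exact: (@rV_compact R n.+1 (fun=> `[0 : R, 1]%classic)
      (fun=> @segment_compact R 0 1)).
  apply: (@closed_comp _ _ (fun v : 'rV[R]_n.+1 => \sum_i v ord0 i ^+ 2) [set 1]).
    move=> v _; move: v; apply: continuous_big => [|i _ v]; first exact: add_continuous.
    by apply: continuousM; exact: coordc.
  exact: closed_eq.
have fE : f = fun v => \sum_g A g * \prod_j v ord0 (g j).
  apply/funext => v; rewrite /f tensor_formE; apply: eq_bigr => g _.
  by congr (_ * _); apply: eq_bigr => j _; rewrite mxE.
have fc : {within S, continuous f}.
  rewrite fE; apply: continuous_subspaceT.
  apply: continuous_big => [|g _ v]; first exact: add_continuous.
  apply: continuousM; first exact: cst_continuous.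
  by apply: continuous_big => [|j _]; [exact: mul_continuous|exact: coordc].
have [c] := derive.EVT_min_rV S0 Sc fc.
rewrite inE => /SE [c0 c1] cmin.
have zmin z : nonneg_vec z -> norm2 z = 1 -> f c <= tensor_form A z.
  move=> z0 z1; rewrite -[z]trmxK; apply: cmin; rewrite inE; apply/SE.
  by rewrite trmxK.
have fcmu : f c = mu A.
  set T := [set tensor_form A y | y in [set y | nonneg_vec y /\ norm2 y = 1]].
  have [[w [w0 w1] wmu] hw] : is_min T (mu A).
    apply: (xgetPex 0 (P := [set v | is_min T v])).
    exists (f c); split; first by exists c^T.
    by move=> _ [z [z0 z1] <-]; exact: zmin.
  by apply/le_anti; rewrite -{1}wmu zmin //= hw //; exists c^T.
by exists c^T; split=> // z z0 z1; rewrite -fcmu; exact: zmin.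
Qed.

(** Homogeneity extends the bound from unit vectors to the whole cone. *)
Lemma mu_norm2_le_form (R : realType) m n (A : tensor R m.+1 n.+1) z :
  nonneg_vec z -> mu A * norm2 z ^+ m.+1 <= tensor_form A z.
Proof.
move=> z0; have [y [_ _ _ ymin]] := mu_attained A.
have [/eqP|nz] := eqVneq (norm2 z) 0.
  (* The zero vector is 0 times itself, so homogeneity makes the form vanish. *)
  rewrite norm2_eq0 => /eqP ->; rewrite -(scale0r (0 : 'cV[R]_n.+1)).
  by rewrite norm2Z tensor_formZ normr0 mul0r expr0n mulr0 mul0r.
have np : 0 < norm2 z by rewrite lt_def nz norm2_ge0.
have := ymin ((norm2 z)^-1 *: z); rewrite tensor_formZ norm2Z.
rewrite gtr0_norm ?invr_gt0 // mulVf // => /(_ _ erefl).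
rewrite exprVn mulrC ler_pdivlMr ?exprn_gt0 //; apply => i.
by rewrite mxE mulr_ge0 ?invr_ge0 ?norm2_ge0.
Qed.

(** A nonpositive minimum would be undercut by shrinking a coordinate of the
    minimizer along which the form increases, since this only shortens the
    vector. *)
Lemma mu_gt0 (R : realType) m n (A : tensor R m.+1 n.+1) :
  symmetric_tensor A -> strictly_semi_positive A -> 0 < mu A.
Proof.
move=> sA pA; have [y [y0 y1 ymu _]] := mu_attained A.
have [|k [yk gk]] := pA y y0.
  by move=> yz; move: (oner_neq0 R); rewrite -y1 yz norm2_eq0 eqxx.
rewrite ltNge; apply/negP => mu0.
have : 0 <= (line_poly A y k)^`().[0].
  (* The range t < y k 0 keeps the k-th coordinate of y - t e_k nonnegative. *)
  apply: (deriv_ge0_at_right_min yk) => t /andP[t0 tk].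
  rewrite !horner_line_poly scale0r subr0 ymu.
  set z := y - _.
  have zi i : 0 <= z i 0 <= y i 0.
    rewrite !mxE eqxx andbT; have := y0 i.
    by have [->|_] := eqVneq i k; rewrite ?mulr1 ?mulr0; lra.
  have z0 : nonneg_vec z by move=> i; have /andP[] := zi i.
  (* As mu A <= 0, the bound mu A * norm2 z ^+ m.+1 is at least mu A. *)
  apply: le_trans (mu_norm2_le_form A z0).
  have : norm2 z ^+ m.+1 <= 1.
    by rewrite exprn_ile1 ?norm2_ge0 // -y1 ler_norm2.
  by move=> h; rewrite -[leLHS]mulr1 ler_wnM2l.
by rewrite deriv_line_poly // oppr_ge0 leNgt mulr_gt0 ?ltr0Sn.
Qed.

(** * The bound on solutions *)

Theorem theorem3p7 (R : realType) (m n : nat) (hm : (2 <= m)%N) (hn : (1 <= n)%N)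
    (A : tensor R m n) (hsym : symmetric_tensor A)
    (hssp : strictly_semi_positive A) (q x : 'cV[R]_n)
    (hx : TCP_solution A q x) :
  norm2 x ^+ m.-1 <= norm2 (pos_part (- q)) / mu A.
Proof.
case: m hm A hsym hssp hx => // m hm A hsym hssp [x0 _ compl].
case: n hn A q x hsym hssp x0 compl => // n _ A q x hsym hssp x0 compl.
have mu0 := mu_gt0 hsym hssp.
rewrite ler_pdivlMr //= mulrC.
have [/eqP|nx] := eqVneq (norm2 x) 0.
  rewrite norm2_eq0 => /eqP ->.
  have /eqP -> : norm2 (0 : 'cV[R]_n.+1) == 0 by rewrite norm2_eq0.
  have /negPf m0 : m != 0%N by rewrite -lt0n.
  by rewrite expr0n m0 mulr0 norm2_ge0.
have xp : 0 < norm2 x by rewrite lt_def nx norm2_ge0.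
rewrite -(ler_pM2l xp) mulrCA -exprS.
apply: le_trans (mu_norm2_le_form A x0) _.
apply: le_trans (dot_le_norm2 _ _).
have -> : tensor_form A x = \sum_i x i 0 * (- q) i 0.
  rewrite -dotE; apply/eqP; rewrite -subr_eq0 -compl /tensor_form !dotE -sumrB.
  by apply/eqP; apply: eq_bigr => i _; rewrite !mxE; ring.
rewrite dotE; apply: ler_sum => i _; rewrite [pos_part _ _ _]mxE.
by rewrite ler_wpM2l // le_max lexx.
Qed.
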